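(* Let a network be given by a directed graph $G=(V,A)$ with arc resistances $\beta_a>0$ ($a\in A$), a source $s\in V$, a sink $t\in V$ (with $s\neq t$), and a potential interval $[\pi_{\min},\pi_{\max}]$. Let $x^*\in\mathbb{R}^A$ be a feasible stationary gas $s$-$t$-flow of maximum value. Then $(x^*,x^* )$ is an optimal solution to the maximum $2$-stage gas $s$-$t$-flow problem, i.e., $(x^*,x^* )$ is a feasible $2$-stage gas $s$-$t$-flow whose value is maximum among all feasible $2$-stage gas $s$-$t$-flows in the network.
   Context: Graphs are finite. A stationary gas flow is a vector $x\in\mathbb{R}^A$ for which there exist node potentials $\pi\in\mathbb{R}^V$ with $\beta_a x_a|x_a|=\pi_u-\pi_v$ for every arc $a=(u,v)\in A$ (we say that $\pi$ induces $x$; negative $x_a$ means flow from $v$ to $u$). It is feasible if such inducing potentials can be chosen with $\pi_{\min}\le\pi_v\le\pi_{\max}$ for all $v\in V$. A vector $x\in\mathbb{R}^A$ satisfies supplies and demands $b\in\mathbb{R}^V$ if $\sum_{a\in\delta^+(v)}x_a-\sum_{a\in\delta^-(v)}x_a=b_v$ for all $v\in V$, where $\delta^+(v)$ and $\delta^-(v)$ are the sets of arcs leaving and entering $v$. A stationary gas $s$-$t$-flow of value $q$ is a stationary gas flow satisfying supplies and demands $b$ with $b_s=-b_t=q$ and $b_v=0$ for $v\in V\setminus\{s,t\}$. A $2$-stage gas flow is a pair $(x^1,x^2)$ of stationary gas flows. It is feasible if both $x^1$ and $x^2$ are feasible stationary gas flows. If $x^i$ satisfies supplies and demands $b^i\in\mathbb{R}^V$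 for $i=1,2$, then $(x^1,x^2)$ in total satisfies supplies and demands $b=b^1+b^2$. It is a $2$-stage gas $s$-$t$-flow of value $q$ if $b_s=-b_t=q$ and $b_v=0$ for all $v\in V\setminus\{s,t\}$ (the individual $x^1,x^2$ need not be $s$-$t$-flows). The maximum $2$-stage gas $s$-$t$-flow problem asks for a feasible $2$-stage gas $s$-$t$-flow of maximum value. *)

(* Defs.v *)
From HB Require Import structures.
From mathcomp Require Import all_boot all_order all_algebra.
From mathcomp Require Import reals.

Set Implicit Arguments.
Unset Strict Implicit.
Unset Printing Implicit Defensive.

Import Order.TTheory GRing.Theory Num.Theory.
Local Open Scope ring_scope.

(* Arcs form a type of their own, with endpoint maps, so that parallel arcs,
   anti-parallel arcs and loops are allowed; a digraph with A a subset of V * V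
   is the case where [A] is the subtype of its arcs and [tail], [head] are the
   two projections. *)
Record gas_network (R : realType) (V A : finType) := GasNetwork {
  tail : A -> V;
  head : A -> V;
  resistance : A -> R;
  source : V;
  sink : V;
  pi_min : R;
  pi_max : R;
  resistance_gt0 : forall a, 0 < resistance a;
  source_neq_sink : source != sink;
  pi_min_le_max : pi_min <= pi_max
}.

Section GasFlows.
Variables (R : realType) (V A : finType) (N : gas_network R V A).
Implicit Types (x : {ffun A -> R}) (pi b : {ffun V -> R}) (q : R) (v : V).
Implicit Types X : {ffun A -> R} * {ffun A -> R}.

Definition induces pi x : Prop :=
  forall a : A,
    resistance N a * x a * `|x a| = pi (tail N a) - pi (head N a).

Definition stationary_gas_flow x : Prop := exists pi, induces pi x.

Definition feasible_gas_flow x : Prop :=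
  exists2 pi, induces pi x & forall v, pi_min N <= pi v <= pi_max N.

Definition satisfies_supplies x b : Prop :=
  forall v, \sum_(a | tail N a == v) x a - \sum_(a | head N a == v) x a = b v.

Definition st_supplies q b : Prop :=
  [/\ b (source N) = q, - b (sink N) = q
    & forall v, v != source N -> v != sink N -> b v = 0].

Definition gas_st_flow q x : Prop :=
  stationary_gas_flow x /\
  exists2 b, satisfies_supplies x b & st_supplies q b.

Definition max_feasible_gas_st_flow x : Prop :=
  exists q, [/\ feasible_gas_flow x, gas_st_flow q x
    & forall (y : {ffun A -> R}) (r : R),
        feasible_gas_flow y -> gas_st_flow r y -> r <= q].

Definition two_stage_gas_flow X : Prop :=
  stationary_gas_flow X.1 /\ stationary_gas_flow X.2.

Definition feasible_two_stage X : Prop :=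
  feasible_gas_flow X.1 /\ feasible_gas_flow X.2.

Definition satisfies_in_total X b : Prop :=
  exists b1 b2, [/\ satisfies_supplies X.1 b1, satisfies_supplies X.2 b2
    & b = b1 + b2].

(* Only the total supplies are those of an s-t-flow: each stage on its own may
   have nonzero net supply at any node. *)
Definition two_stage_gas_st_flow q X : Prop :=
  two_stage_gas_flow X /\
  exists2 b, satisfies_in_total X b & st_supplies q b.

Definition max_feasible_two_stage_gas_st_flow X : Prop :=
  exists q, [/\ feasible_two_stage X, two_stage_gas_st_flow q X
    & forall (Y : {ffun A -> R} * {ffun A -> R}) (r : R),
        feasible_two_stage Y -> two_stage_gas_st_flow r Y -> r <= q].

End GasFlows.

(* Main.v *)
Require Import Defs.
From mathcomp Require Import all_boot all_order all_algebra.
From mathcomp Require Import reals.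
From mathcomp Require Import ring lra.
From mathcomp Require Import boolp classical_sets topology normedtype realfun.

Set Implicit Arguments.
Unset Strict Implicit.
Unset Printing Implicit Defensive.

Import Defs Order.TTheory GRing.Theory Num.Theory numFieldNormedType.Exports.
Local Open Scope ring_scope.

(** Let [D] be [pi_max N - pi_min N], let [q] be the largest value of a
feasible stationary flow and let [(x1, x2)] be a feasible two-stage flow of
value [r], so that [r <= 2 q] is to be shown.

The mean [m = (x1 + x2) / 2] of the stages is an s-t-flow of value [r / 2], but
it is usually not stationary.  It behaves, however, like a stationary flow for
the mean [p] of the two potentials in a network whose resistances are at least
the given ones: [beta |m|^3 <= m (p_u - p_v)] on every arc [(u, v)], which is
[cube_sum_le].  Raising resistances cannot help (there is no Braess paradox for
potential-driven flows).  To see this, compare [m] with a stationary s-t-flow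
[y] of value [q'] whose potentials drop by all of [D] from source to sink.
Summation by parts ([st_supplies_sum]) gives
  [\sum beta |y|^3 = q' D],  [\sum beta y |y| m = (r / 2) D]  and
  [\sum beta |m|^3 <= (r / 2) (p_s - p_t) <= (r / 2) D]  when [0 <= r],
and Young's inequality [3 m y |y| <= 2 |y|^3 + |m|^3] ([young_cube]) turns them
into [r <= 2 q'] when [0 < D].  When [D = 0] nothing flows at all.

The argument needs a flow [y] that exhausts the potential interval; it is then
feasible, so [q' <= q].  It is produced by Perron's method: among the
potentials in the box that are [pi_min N] at the sink and for which no inner
node has positive net outflow, the pointwise supremum is again such a
potential.  If an inner node had negative net outflow there, its potential
could be raised a little, contradicting the supremum; hence flow is conserved at
all inner nodes.  The supremum is [pi_max N] at the source because the potential
equal to [pi_max N] there and to [pi_min N] elsewhere belongs to the family. *)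

(** * Inequalities on a single arc *)

(** Young's inequality with exponents 3 and 3/2: for nonnegative [a] and [b],
[2 b^3 + a^3 - 3 a b^2 = (a - b)^2 (a + 2 b)]. *)
Lemma young_cube (R : realDomainType) (m y : R) :
  3 * (m * (y * `|y|)) <= 2 * `|y| ^+ 3 + `|m| ^+ 3.
Proof.
have key (a b : R) : 0 <= a -> 0 <= b -> 3 * (a * b ^+ 2) <= 2 * b ^+ 3 + a ^+ 3.
  move=> a0 b0; rewrite -subr_ge0.
  have -> : 2 * b ^+ 3 + a ^+ 3 - 3 * (a * b ^+ 2)
      = (a - b) ^+ 2 * (a + 2 * b) by ring.
  by rewrite mulr_ge0 ?sqr_ge0 ?addr_ge0 ?mulr_ge0.
apply: le_trans (key `|m| `|y| (normr_ge0 _) (normr_ge0 _)).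
rewrite ler_pM2l ?ltr0n//.
by apply: le_trans (ler_norm _) _; rewrite !normrM normr_id expr2.
Qed.

(** The signed square of the mean of two numbers may exceed the mean of their
signed squares, since the signed square is concave on negative numbers.
Multiplying by the mean cures this: when [0 <= x + y], the difference of the two
sides is [(x + y) (x - y)^2] if both numbers are nonnegative, and
[(x + y)^2 (x - 3 y)] if [y < 0 <= x]. *)
Lemma cube_sum_le (R : realDomainType) (x y : R) :
  `|x + y| ^+ 3 <= 2 * ((x + y) * (x * `|x| + y * `|y|)).
Proof.
have swap (a b : R) : a * `|a| + b * `|b| = b * `|b| + a * `|a| by rewrite addrC.
wlog xy0 : x y / 0 <= x + y.
  move=> H; case: (leP 0 (x + y)) => [/H //|h].
  have := H (- x) (- y); rewrite !normrN -opprD normrN => H'.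
  have -> : (x + y) * (x * `|x| + y * `|y|)
      = - (x + y) * (- x * `|x| + - y * `|y|) by ring.
  by apply: H'; rewrite oppr_ge0 ltW.
wlog xy : x y xy0 / y <= x.
  move=> H; case: (leP y x) => [|/ltW] h; first exact: H.
  by rewrite (addrC x) swap; apply: H => //; rewrite addrC.
have x0 : 0 <= x by lra.
rewrite (ger0_norm xy0) (ger0_norm x0); case: (leP 0 y) => y0.
- rewrite (ger0_norm y0) -subr_ge0.
  have -> : 2 * ((x + y) * (x * x + y * y)) - (x + y) ^+ 3
      = (x + y) * (x - y) ^+ 2 by ring.
  by rewrite mulr_ge0 ?sqr_ge0.
- rewrite (ltr0_norm y0) -subr_ge0.
  have -> : 2 * ((x + y) * (x * x + y * - y)) - (x + y) ^+ 3
      = (x + y) ^+ 2 * (x - 3 * y) by ring.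
  by rewrite mulr_ge0 ?sqr_ge0//; lra.
Qed.

(** [young_cube] at [m = (x1 + x2) / 2] combined with [cube_sum_le], cleared of
denominators. *)
Lemma two_stage_arc_le (R : realFieldType) (y x1 x2 : R) :
  6 * ((x1 + x2) * (y * `|y|))
  <= 8 * `|y| ^+ 3 + (x1 + x2) * (x1 * `|x1| + x2 * `|x2|).
Proof.
have := young_cube ((x1 + x2) / 2) y; have := cube_sum_le x1 x2.
rewrite normrM (gtr0_norm (_ : 0 < 2^-1)) ?invr_gt0 ?ltr0n// exprMn.
have -> : (x1 + x2) / 2 * (y * `|y|) = (x1 + x2) * (y * `|y|) / 2 by ring.
by move: (`|x1 + x2| ^+ 3) (_ * (_ + _)) => z3 zF; lra.
Qed.

(** * The flow on an arc as a function of the potential drop *)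

Section SignedSqrt.
Variable R : realType.
Implicit Types c d : R.

(** [Num.sqrt] vanishes on negative numbers, so at most one of the two terms is
nonzero; monotonicity and continuity are inherited from [Num.sqrt]. *)
Definition signed_sqrt d : R := Num.sqrt d - Num.sqrt (- d).

Lemma signed_sqrtK d : signed_sqrt d * `|signed_sqrt d| = d.
Proof.
rewrite /signed_sqrt; case: (leP 0 d) => d0.
- by rewrite (ler0_sqrtr (_ : - d <= 0)) ?oppr_le0// subr0
    ger0_norm ?sqrtr_ge0// -expr2 sqr_sqrtr.
- rewrite (ler0_sqrtr (ltW d0)) sub0r normrN ger0_norm ?sqrtr_ge0//.
  by rewrite mulNr -expr2 sqr_sqrtr ?opprK// oppr_ge0 ltW.
Qed.

Lemma ler_signed_sqrt c d : c <= d -> signed_sqrt c <= signed_sqrt d.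
Proof. by move=> cd; rewrite lerB// ler_wsqrtr// lerN2. Qed.

Lemma signed_sqrt_ge0 d : 0 <= d -> 0 <= signed_sqrt d.
Proof. by move/ler_signed_sqrt; rewrite /signed_sqrt oppr0 subrr. Qed.

Lemma signed_sqrt_le0 d : d <= 0 -> signed_sqrt d <= 0.
Proof. by move/ler_signed_sqrt; rewrite /signed_sqrt oppr0 subrr. Qed.

Lemma continuous_signed_sqrt : continuous signed_sqrt.
Proof.
move=> d; apply: cvgB; first exact: sqrt_continuous.
apply: (@cvg_comp _ _ _ (@GRing.opp R) (@Num.sqrt R) _ (nbhs (- d))).
  by apply: cvgN; exact: cvg_id.
exact: sqrt_continuous.
Qed.

End SignedSqrt.

(** * Net outflow and summation by parts *)

Section Network.
Variables (R : realType) (V A : finType) (N : gas_network R V A).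
Implicit Types (x : {ffun A -> R}) (p b : {ffun V -> R}) (v w : V) (c q : R).

Definition net_outflow x v : R :=
  \sum_(a | tail N a == v) x a - \sum_(a | head N a == v) x a.

Lemma sum_potential_net_outflow x p :
  \sum_v p v * net_outflow x v
  = \sum_a x a * (p (tail N a) - p (head N a)).
Proof.
have side (e : A -> V) :
    \sum_v p v * (\sum_(a | e a == v) x a) = \sum_a x a * p (e a).
  rewrite [RHS](partition_big e predT)//=; apply: eq_bigr => v _.
  by rewrite mulr_sumr; apply: eq_bigr => a /eqP ->; rewrite mulrC.
under eq_bigr do rewrite mulrBr.
by rewrite sumrB !side -sumrB; apply: eq_bigr => a _; rewrite mulrBr.
Qed.

Definition conserving x :=
  forall v, v != source N -> v != sink N -> net_outflow x v = 0.

Lemma conserving_sum x p : conserving x ->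
  \sum_a x a * (p (tail N a) - p (head N a))
  = p (source N) * net_outflow x (source N) + p (sink N) * net_outflow x (sink N).
Proof.
move=> xC; rewrite -sum_potential_net_outflow (bigD1 (source N))//=.
rewrite (bigD1 (sink N))/= ?(eq_sym _ (source N)) ?source_neq_sink//.
rewrite [X in _ + (_ + X)]big1 ?addr0// => v /andP[vs vt].
by rewrite xC ?mulr0.
Qed.

(** The balance at the sink follows from the balance elsewhere: summation by
parts against the constant potential 1 shows that all net outflows add up to
zero. *)
Lemma conserving_st_supplies x b : conserving x -> satisfies_supplies N x b ->
  st_supplies N (net_outflow x (source N)) b.
Proof.
move=> xC xb; have bE v : b v = net_outflow x v by rewrite -xb.
split; rewrite ?bE//.
- have := conserving_sum [ffun=> 1] xC; rewrite !ffunE !mul1r.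
  under eq_bigr do rewrite !ffunE subrr mulr0.
  by rewrite sumr_const mul0rn => /eqP; rewrite eq_sym addr_eq0 => /eqP ->.
- by move=> v vs vt; rewrite bE xC.
Qed.

Lemma st_supplies_sum q b x p : satisfies_supplies N x b -> st_supplies N q b ->
  \sum_a x a * (p (tail N a) - p (head N a))
  = q * (p (source N) - p (sink N)).
Proof.
move=> xb [bs bt b0]; have bE v : net_outflow x v = b v by exact: xb.
rewrite conserving_sum ?bE.
  by rewrite bs -[b _]opprK bt; ring.
by move=> v vs vt; rewrite bE b0.
Qed.

(** * Flows induced by potentials *)

Definition potential_flow p : {ffun A -> R} :=
  [ffun a => signed_sqrt ((p (tail N a) - p (head N a)) / resistance N a)].

Lemma induces_potential_flow p : induces N p (potential_flow p).
Proof.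
move=> a; rewrite ffunE -mulrA signed_sqrtK mulrC divfK//.
by rewrite gt_eqF ?resistance_gt0.
Qed.

Definition set_potential p v c : {ffun V -> R} :=
  [ffun w => if w == v then c else p w].

Lemma set_potentialE p v c w :
  set_potential p v c w = if w == v then c else p w.
Proof. exact: ffunE. Qed.

Lemma set_potential_id p v : set_potential p v (p v) = p.
Proof. by apply/ffunP => w; rewrite set_potentialE; case: eqP => [->|]. Qed.

(** Raising the potential of other nodes only pushes flow towards [v]. *)
Lemma net_outflow_anti p p' v : (forall w, p w <= p' w) -> p v = p' v ->
  net_outflow (potential_flow p') v <= net_outflow (potential_flow p) v.
Proof.
move=> pp' pv; have r0 a : 0 <= (resistance N a)^-1.
  by rewrite invr_ge0 ltW ?resistance_gt0.
rewrite /net_outflow lerB//; apply: ler_sum => a /eqP av;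
  by rewrite !ffunE ler_signed_sqrt// ler_wpM2r// lerB// av pv.
Qed.

Lemma net_outflow_ge0_at_max p v : (forall w, p w <= p v) ->
  0 <= net_outflow (potential_flow p) v.
Proof.
move=> pv; have r0 a : 0 <= (resistance N a)^-1.
  by rewrite invr_ge0 ltW ?resistance_gt0.
rewrite subr_ge0 (@le_trans _ _ 0)//; [apply: sumr_le0|apply: sumr_ge0] => a /eqP av;
  rewrite ffunE; [apply: signed_sqrt_le0|apply: signed_sqrt_ge0].
- by rewrite mulr_le0_ge0// av subr_le0.
- by rewrite mulr_ge0// av subr_ge0.
Qed.

Lemma net_outflow_le0_at_min p v : (forall w, p v <= p w) ->
  net_outflow (potential_flow p) v <= 0.
Proof.
move=> pv; have r0 a : 0 <= (resistance N a)^-1.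
  by rewrite invr_ge0 ltW ?resistance_gt0.
rewrite subr_le0 (@le_trans _ _ 0)//; [apply: sumr_le0|apply: sumr_ge0] => a /eqP av;
  rewrite ffunE; [apply: signed_sqrt_le0|apply: signed_sqrt_ge0].
- by rewrite mulr_le0_ge0// av subr_le0.
- by rewrite mulr_ge0// av subr_ge0.
Qed.

Lemma continuous_net_outflow p v :
  continuous (fun c => net_outflow (potential_flow (set_potential p v c)) v).
Proof.
have sum_cont (e : A -> V) : continuous (fun c =>
    \sum_(a | e a == v) potential_flow (set_potential p v c) a).
  apply: continuous_big => [c0|a _ c0]; first exact: add_continuous.
  under eq_fun do rewrite ffunE.
  apply: (@cvg_comp _ _ _ _ (@signed_sqrt R) _ (nbhs _)); last first.
    exact: continuous_signed_sqrt.
  apply: cvgMr_tmp; apply: cvgB; under eq_fun do rewrite set_potentialE;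
    rewrite set_potentialE; case: eqP => _;
    by [exact: cvg_id|exact: cvg_cst].
by move=> c0; apply: cvgB; apply: sum_cont.
Qed.

(** * A flow with the maximal potential drop *)

(** The family for Perron's method.  Only the sink is pinned: at the source it is
[source_subsolution] that lifts the supremum to [pi_max N]. *)
Record subsolution p : Prop := Subsolution {
  subsolution_box : forall v, pi_min N <= p v <= pi_max N;
  subsolution_sink : p (sink N) = pi_min N;
  subsolution_le0 : forall v, v != source N -> v != sink N ->
    net_outflow (potential_flow p) v <= 0 }.

(** Every inner node has the least potential of all, so that nothing flows out of
it. *)
Lemma source_subsolution :
  subsolution [ffun v => if v == source N then pi_max N else pi_min N].
Proof.
have mM := pi_min_le_max N.
split=> [v||v vs vt].
- by rewrite ffunE; case: ifP; rewrite lexx ?mM.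
- by rewrite ffunE eq_sym (negbTE (source_neq_sink N)).
- apply: net_outflow_le0_at_min => w; rewrite !ffunE (negbTE vs).
  by case: ifP.
Qed.

Definition envelope : {ffun V -> R} :=
  [ffun v => sup [set p v | p in subsolution]%classic].

Lemma subsolution_le_envelope p v : subsolution p -> p v <= envelope v.
Proof.
move=> pS; rewrite ffunE; apply: ub_le_sup; last by exists p.
by exists (pi_max N) => _ [p' [/(_ v)/andP[_ pM] _ _] <-].
Qed.

Lemma envelope_le v c : (forall p, subsolution p -> p v <= c) -> envelope v <= c.
Proof.
move=> vc; rewrite ffunE; apply: ge_sup.
  by eexists; eexists; first exact: source_subsolution.
by move=> _ [p pS <-]; exact: vc.
Qed.

Lemma envelope_adherent v (e : R) : 0 < e ->
  exists2 p, subsolution p & envelope v - e < p v.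
Proof.
move=> e0; apply: contrapT => H.
suff : envelope v <= envelope v - e by rewrite lerBrDr gerDl leNgt e0.
apply: envelope_le => p pS; rewrite leNgt; apply/negP => pv.
by apply: H; exists p.
Qed.

(** At an inner node [v], take a subsolution whose potential [c] at [v] is close
to that of the envelope.  By [net_outflow_anti] the net outflow at [v] stays
nonpositive when all other nodes are raised to the envelope, and letting [c] tend
to the envelope preserves this. *)
Lemma envelope_subsolution : subsolution envelope.
Proof.
split=> [v||v vs vt].
- rewrite envelope_le ?andbT; last by move=> p [/(_ v)/andP[]].
  apply: le_trans (subsolution_le_envelope v source_subsolution).
  by have /andP[] := subsolution_box source_subsolution v.
- apply/eqP; rewrite eq_le envelope_le => [|p [_ -> _]//].
  rewrite -{1}(subsolution_sink source_subsolution).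
  exact/subsolution_le_envelope/source_subsolution.
- rewrite leNgt; apply/negP => out_gt0.
  have := @continuous_net_outflow envelope v (envelope v).
  rewrite /continuous_at set_potential_id => /cvgr_gt/(_ _ out_gt0).
  move=> /nbhs_ballP[e /= e0 near_gt0].
  have [p pS pv] := envelope_adherent v e0.
  have pE := subsolution_le_envelope v pS.
  have : 0 < net_outflow (potential_flow (set_potential envelope v (p v))) v.
    by apply: near_gt0; rewrite /ball/= ger0_norm ?subr_ge0//; lra.
  rewrite ltNge => /negP; apply.
  apply: le_trans (subsolution_le0 pS vs vt); apply: net_outflow_anti.
    move=> w; rewrite set_potentialE; case: eqP => [->//|_].
    exact: subsolution_le_envelope.
  by rewrite set_potentialE eqxx.
Qed.

Lemma envelope_source : envelope (source N) = pi_max N.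
Proof.
apply/eqP; rewrite eq_le.
have /andP[_ ->] /= := subsolution_box envelope_subsolution (source N).
have := subsolution_le_envelope (source N) source_subsolution.
by rewrite [X in X <= _ -> _]ffunE eqxx.
Qed.

(** If the net outflow at [v] were negative, then [envelope v < pi_max N] by
[net_outflow_ge0_at_max], and raising the potential of [v] slightly would give a
larger subsolution: the sign at [v] survives by continuity, and the net outflow
at other nodes only decreases. *)
Lemma envelope_conserving : conserving (potential_flow envelope).
Proof.
move=> v vs vt; apply/eqP; rewrite eq_le (subsolution_le0 envelope_subsolution)//=.
rewrite leNgt; apply/negP => out_lt0.
have box := subsolution_box envelope_subsolution.
have vM : envelope v < pi_max N.
  rewrite lt_neqAle; have /andP[_ ->] := box v; rewrite andbT; apply/eqP => vM.
  suff : 0 <= net_outflow (potential_flow envelope) v by rewrite leNgt out_lt0.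
  by apply: net_outflow_ge0_at_max => w; rewrite vM; have /andP[] := box w.
have := @continuous_net_outflow envelope v (envelope v).
rewrite /continuous_at set_potential_id => /cvgr_lt/(_ _ out_lt0).
move=> /nbhs_ballP[e /= e0 near_lt0].
pose c := Num.min (envelope v + e / 2) (pi_max N).
have vc : envelope v < c by rewrite lt_min vM andbT; lra.
have ce : c <= envelope v + e / 2 by rewrite ge_min lexx.
have cM : c <= pi_max N by rewrite ge_min lexx orbT.
suff : subsolution (set_potential envelope v c).
  by move=> /(subsolution_le_envelope v); rewrite set_potentialE eqxx leNgt vc.
split=> [w||w ws wt].
- rewrite set_potentialE; case: eqP => // _; rewrite cM andbT.
  by apply: le_trans (ltW vc); have /andP[] := box v.
- rewrite set_potentialE eq_sym (negbTE vt).
  exact: subsolution_sink envelope_subsolution.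
- have [->|wv] := eqVneq w v.
    apply/ltW/near_lt0; rewrite /ball/= ltr_norml.
    by apply/andP; split; lra.
  apply: le_trans (subsolution_le0 envelope_subsolution ws wt).
  apply: net_outflow_anti => [u|]; rewrite set_potentialE ?(negbTE wv)//.
  by case: eqP => [->|//]; exact: ltW.
Qed.

Lemma satisfies_net_outflow x : satisfies_supplies N x [ffun v => net_outflow x v].
Proof. by move=> v; rewrite ffunE. Qed.

(** No positivity of the value is asserted: when source and sink are not
connected, the value is zero although the potential drop is maximal. *)
Lemma exists_full_drop_flow : exists y q, [/\ gas_st_flow N q y &
  exists p, [/\ induces N p y, forall v, pi_min N <= p v <= pi_max N,
    p (source N) = pi_max N & p (sink N) = pi_min N]].
Proof.
exists (potential_flow envelope), (net_outflow (potential_flow envelope) (source N)).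
split; first split.
- by exists envelope; exact: induces_potential_flow.
- exists [ffun v => net_outflow (potential_flow envelope) v].
    exact: satisfies_net_outflow.
  apply: conserving_st_supplies; first exact: envelope_conserving.
  exact: satisfies_net_outflow.
- exists envelope; split.
  + exact: induces_potential_flow.
  + exact: subsolution_box envelope_subsolution.
  + exact: envelope_source.
  + exact: subsolution_sink envelope_subsolution.
Qed.

(** * Comparison of two-stage flows with a full-drop flow *)

Lemma feasible_flow_eq0 x : pi_min N = pi_max N -> feasible_gas_flow N x -> x = 0.
Proof.
move=> mM [p px pbox]; apply/ffunP => a; rewrite ffunE.
have pE v : p v = pi_max N.
  by apply/eqP; rewrite eq_le -{2}mM andbC; exact: pbox.
have /eqP := px a; rewrite !pE subrr !mulf_eq0 normr_eq0.
by rewrite gt_eqF ?resistance_gt0//= orbb => /eqP.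
Qed.

Lemma satisfies_supplies0 b : satisfies_supplies N 0 b -> b = 0.
Proof.
move=> b0; apply/ffunP => v; rewrite -b0 ffunE.
by rewrite !big1 ?subrr// => a _; rewrite ffunE.
Qed.

Lemma satisfies_suppliesD x1 x2 b1 b2 : satisfies_supplies N x1 b1 ->
  satisfies_supplies N x2 b2 -> satisfies_supplies N (x1 + x2) (b1 + b2).
Proof.
move=> xb1 xb2 v; rewrite ffunE -xb1 -xb2.
under eq_bigr do rewrite ffunE.
under [X in _ - X]eq_bigr do rewrite ffunE.
by rewrite !big_split/=; ring.
Qed.

Lemma st_suppliesD q1 q2 b1 b2 : st_supplies N q1 b1 -> st_supplies N q2 b2 ->
  st_supplies N (q1 + q2) (b1 + b2).
Proof.
move=> [s1 t1 o1] [s2 t2 o2]; split=> [||v vs vt]; rewrite ffunE ?s1 ?s2//.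
- by rewrite opprD t1 t2.
- by rewrite o1// o2// addr0.
Qed.

Lemma energy_eq y q p : gas_st_flow N q y -> induces N p y ->
  \sum_a resistance N a * `|y a| ^+ 3 = q * (p (source N) - p (sink N)).
Proof.
move=> [_ [b yb bq]] py; rewrite -(st_supplies_sum p yb bq).
apply: eq_bigr => a _; rewrite -py.
have -> : `|y a| ^+ 3 = `|y a| ^+ 2 * `|y a| by ring.
by rewrite real_normK ?num_real//; ring.
Qed.

(** The sums of [two_stage_arc_le], weighted by the resistances, read
[6 r D <= 8 q D + r (D1 + D2)], where [D] is the length of the potential
interval and [D1], [D2] are the potential drops of the two stages from source to
sink.  The bounds [D1, D2 <= D] finish the
estimate only when [0 <= r]; for negative [r] it suffices that [0 <= q]. *)
Lemma two_stage_value_le y q p X r :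
  feasible_gas_flow N y -> gas_st_flow N q y -> induces N p y ->
  p (source N) = pi_max N -> p (sink N) = pi_min N ->
  feasible_two_stage N X -> two_stage_gas_st_flow N r X -> r <= q + q.
Proof.
case: X => x1 x2 yF yq py ps pt [/= x1F x2F] [_ [b [b1 [b2 [/= xb1 xb2 bE]]] br]].
have [mM|mM] := eqVneq (pi_min N) (pi_max N).
  have r0 : r = 0.
    move: xb1 xb2; rewrite (feasible_flow_eq0 mM x1F) (feasible_flow_eq0 mM x2F).
    move=> /satisfies_supplies0 b10 /satisfies_supplies0 b20; case: br => <- _ _.
    by rewrite bE b10 b20 !ffunE addr0.
  have q0 : q = 0.
    case: yq => _ [b' + [<- _ _]]; rewrite (feasible_flow_eq0 mM yF).
    by move=> /satisfies_supplies0 ->; rewrite ffunE.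
  by rewrite r0 q0 addr0.
have D0 : 0 < pi_max N - pi_min N by rewrite subr_gt0 lt_neqAle mM pi_min_le_max.
have q_energy := energy_eq yq py.
have q0 : 0 <= q.
  rewrite -(pmulr_lge0 q D0) -ps -pt -q_energy; apply: sumr_ge0 => a _.
  by rewrite mulr_ge0 ?exprn_ge0// ltW ?resistance_gt0.
have [r0|r0] := ltP r 0; first by lra.
have [p1 px1 box1] := x1F; have [p2 px2 box2] := x2F.
have zb := satisfies_suppliesD xb1 xb2; rewrite -bE in zb.
have := st_supplies_sum p zb br.
have := st_supplies_sum p1 zb br; have := st_supplies_sum p2 zb br.
set S2 := \sum_a _ => S2E; set S1 := \sum_a _ => S1E; set S := \sum_a _ => SE.
have : 6 * S <= 8 * (q * (p (source N) - p (sink N))) + (S1 + S2).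
  rewrite -q_energy !mulr_sumr -!big_split; apply: ler_sum => a _ /=.
  rewrite -py -px1 -px2 !ffunE.
  move: (two_stage_arc_le (y a) (x1 a) (x2 a)).
  by move/(ler_wpM2l (ltW (resistance_gt0 N a))) => ?; lra.
rewrite SE S1E S2E ps pt => H.
have drop_le (p' : {ffun V -> R}) : (forall v, pi_min N <= p' v <= pi_max N) ->
    r * (p' (source N) - p' (sink N)) <= r * (pi_max N - pi_min N).
  move=> box; have /andP[_ ?] := box (source N); have /andP[? _] := box (sink N).
  by rewrite ler_wpM2l// lerB.
rewrite -(ler_pM2r D0).
by have := drop_le p1 box1; have := drop_le p2 box2; lra.
Qed.

End Network.

Theorem theorem3 (R : realType) (V A : finType) (N : gas_network R V A)
    (xstar : {ffun A -> R})
    (xstar_max : max_feasible_gas_st_flow N xstar) :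
  max_feasible_two_stage_gas_st_flow N (xstar, xstar).
Proof.
have [q [xF [x_stat [b xb bq]] q_max]] := xstar_max.
exists (q + q); split=> //.
  split=> //; exists (b + b); last exact: st_suppliesD.
  by exists b, b.
move=> X r XF Xr.
have [y [q' [yq [p [py pbox ps pt]]]]] := exists_full_drop_flow N.
have yF : feasible_gas_flow N y by exists p.
apply: le_trans (two_stage_value_le yF yq py ps pt XF Xr) _.
by rewrite lerD// (q_max y).
Qed.
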